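(* Let $\Gamma\in\mathcal S$ have $n$ vertices and let $\varphi$ be an embedding into $\mathbb Z^n$ such that exactly one index $t$ is of type (6), exactly one index is of type (5), and every other index is of type (4) or (7). Then $\Gamma\in\mathcal G$ (in particular $\Gamma$ is a linear chain), and the two vertices $v$ with nonzero coefficient at $E_t$ in $\varphi(v)$ are the two end vertices of the chain.
   Context: A plumbing tree is a finite tree $\Gamma$ each of whose vertices $v$ carries an integer decoration $d(v)$. $\Gamma$ is minimal if no vertex has decoration $-1$. For $n\ge 1$ let $(\mathbb Z^n,Q_n)$ be the lattice with basis $E_1,\dots,E_n$ and $Q_n(E_i,E_j)=-\delta_{ij}$, and let $K=\sum_{i=1}^n E_i$. A plumbing tree $\Gamma$ on $n$ vertices is a symplectic plumbing tree if there is a map $\varphi$ (an embedding) from its vertex set to $\mathbb Z^n$ such that: for distinct vertices $v_1,v_2$, $Q_n(\varphi(v_1),\varphi(v_2))$ is $1$ if they are adjacent and $0$ otherwise; $Q_n(\varphi(v),\varphi(v))=d(v)$ for every $v$; and $Q_n(\varphi(v),K)+Q_n(\varphi(v),\varphi(v))=-2$ for every $v$. $\mathcal S$ is the set of minimal, connected symplectic plumbing trees. Index types: write $\varphi(v)=\sum_i a_{v,i}E_i$; for an index $i$ consider the multiset of nonzero coefficients $a_{v,i}$ as $v$ ranges over all vertices. Index $i$ is of type (1) if this multiset is $\{1\}$, (2) if $\{-1\}$, (3) if $\{-2\}$, (4) if $\{1,-1\}$, (5) if $\{1,-2\}$, (6) if $\{-1,-1\}$, (7) if $\{1,-1,-1\}$,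 (9) if $\{1,-1,-1,-1\}$, and (10) if it is empty. (G) For coprime integers $p>q>0$ write $p^2/(pq-1)=a_1-\cfrac{1}{a_2-\cfrac{1}{\ddots-\cfrac{1}{a_k}}}$ with all $a_i\ge 2$ integers; $\Gamma_{p/q}$ is the linear chain with decorations $-a_1,\dots,-a_k$ in order, and $\mathcal G$ is the set of all $\Gamma_{p/q}$. *)

(* Defs.v *)
From mathcomp Require Import all_boot all_order all_algebra.
Set Implicit Arguments. Unset Strict Implicit. Unset Printing Implicit Defensive.
Import Order.TTheory GRing.Theory Num.Theory.
Local Open Scope ring_scope.

(* A plumbing graph on n vertices: vertex set 'I_n, adjacency e : rel 'I_n,
   decorations d : 'I_n -> int.  Vectors of Z^n are functions 'I_n -> int;
   an embedding is phi : 'I_n -> ('I_n -> int), phi v i = a_{v,i}. *)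

Definition Qn (n : nat) (x y : 'I_n -> int) : int := - \sum_(i < n) x i * y i.

Definition Kvec (n : nat) : 'I_n -> int := fun _ => 1.

Definition is_tree (n : nat) (e : rel 'I_n) : Prop :=
  [/\ (0 < n)%N,
      symmetric e,
      irreflexive e,
      (forall u v, connect e u v) &
      (forall c : seq 'I_n, uniq c -> (2 < size c)%N -> ~~ cycle e c)].

Definition minimal_dec (n : nat) (d : 'I_n -> int) : Prop :=
  forall v, d v != -1.

Definition symplectic_embedding (n : nat) (e : rel 'I_n) (d : 'I_n -> int)
    (phi : 'I_n -> 'I_n -> int) : Prop :=
  [/\ (forall v1 v2, v1 != v2 -> Qn (phi v1) (phi v2) = (if e v1 v2 then 1 else 0)),
      (forall v, Qn (phi v) (phi v) = d v) &
      (forall v, Qn (phi v) (@Kvec n) + Qn (phi v) (phi v) = -2)].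

Definition in_S_via (n : nat) (e : rel 'I_n) (d : 'I_n -> int)
    (phi : 'I_n -> 'I_n -> int) : Prop :=
  [/\ is_tree e, minimal_dec d & symplectic_embedding e d phi].

Definition nz_coeffs (n : nat) (phi : 'I_n -> 'I_n -> int) (i : 'I_n) : seq int :=
  [seq phi v i | v <- enum 'I_n & phi v i != 0].

Definition index_type (n : nat) (phi : 'I_n -> 'I_n -> int) (i : 'I_n)
    (m : seq int) : bool := perm_eq (nz_coeffs phi i) m.

Definition type4 n phi i := @index_type n phi i [:: 1; -1].
Definition type5 n phi i := @index_type n phi i [:: 1; -2].
Definition type6 n phi i := @index_type n phi i [:: -1; -1].
Definition type7 n phi i := @index_type n phi i [:: 1; -1; -1].

Fixpoint hj_value (a : seq int) : rat :=
  match a with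
  | [::] => 0
  | [:: x] => x%:~R
  | x :: s => x%:~R - (hj_value s)^-1
  end.

Definition hj_expansion (a : seq int) (x : rat) : Prop :=
  [/\ a != [::], all (fun y => 2 <= y) a & hj_value a = x].

Definition chain_order (n : nat) (e : rel 'I_n) (s : seq 'I_n) : Prop :=
  [/\ uniq s, size s = n &
      forall u v, e u v = ((index u s).+1 == index v s) || ((index v s).+1 == index u s)].

Definition in_G (n : nat) (e : rel 'I_n) (d : 'I_n -> int) : Prop :=
  exists (p q : nat) (a : seq int) (s : seq 'I_n),
    [/\ coprime p q /\ (0 < q < p)%N,
        hj_expansion a ((p ^ 2)%:R / (p * q - 1)%:R),
        chain_order e s &
        map d s = map (fun y => - y) a].

(* Main.v *)
Require Import Defs.
From mathcomp Require Import all_boot all_order all_algebra.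
From mathcomp Require Import zify ring lra.
Set Implicit Arguments. Unset Strict Implicit. Unset Printing Implicit Defensive.
Import Order.TTheory GRing.Theory Num.Theory.
Local Open Scope ring_scope.

(* Adjunction makes each vertex own a distinguished index (coefficient 1 or -2),
   so a coefficient -1 of u at the index owned by v is an arc u -> v.  A set S of
   vertices spans at most |S| - 1 edges, and the number of edges it spans is a sum
   of local contributions of the indices restricted to S.  Comparing the two on a
   set closed under arcs and on its complement shows that the arcs form no cycle
   and that no index has type (4).  Then every vertex v has degree 2 + a_{v,t},
   so the tree is a chain whose ends are the two vertices meeting E_t.

   For the continued fraction let A be the coefficient matrix.  Acyclicity gives
   p > 0 and an integer matrix B with B A = A B = p, so W = B^T B is an integral
   inverse, up to the factor p^2, of the intersection form A A^T of the chain.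
   The columns of W at the two ends c, d satisfy the three-term recursion of the
   continued fraction, and W_{kc} + W_{kd} = p q_k with q_k = - B_{tk}.  Some q_k
   is 1, which forces W_{cd} = 1, and the fraction is p^2 / W_{cc} with
   W_{cc} = p q_c - 1. *)

(** * Forests, acyclic relations and chains *)

(** If every vertex of [S] had two neighbours in [S], a simple path inside [S] could be prolonged
    for ever: the next vertex is either new or closes a cycle. *)
Lemma acyclic_low_degree (T : finType) (e : rel T) (S : {set T}) :
  symmetric e -> irreflexive e ->
  (forall c : seq T, uniq c -> (2 < size c)%N -> ~~ cycle e c) ->
  S != set0 -> exists2 u, u \in S & (\sum_(v in S) e u v <= 1)%N.
Proof.
move=> sym irr acyc /set0Pn[x0 x0S]; apply/exists_inP; apply: contraT.
rewrite negb_exists => /forallP ndeg.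
have deg2 u : u \in S -> (1 < \sum_(v in S) e u v)%N by move=> uS; have := ndeg u; rewrite uS -ltnNge.
have other u w : u \in S -> exists y, [/\ y \in S, e u y & y != w].
  move=> uS; have gt1 := deg2 u uS.
  suff /existsP[y /and3P[]] : [exists y, [&& y \in S, e u y & y != w]] by exists y.
  apply: contraTT gt1; rewrite negb_exists => /forallP none.
  rewrite -leqNgt (leq_trans (n := \sum_(v in S) (v == w))) //.
    apply: leq_sum => v vS; have := none v; rewrite vS /= negb_and negbK.
    by case: (e u v) => //=; rewrite lt0n => ->.
  rewrite big_mkcond (bigD1 w) //= big1 ?addn0; first by case: ifP; rewrite ?eqxx.
  by move=> v /negPf ->; case: ifP.
have long k : exists x p, [/\ uniq (x :: p), path e x p,
    {subset x :: p <= S} & size p = k].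
  elim: k => [|k [x [p [up pp sub sz]]]].
    by exists x0, [::]; split => // y; rewrite inE => /eqP ->.
  (* The path grows at its head [x]. Since [y] is neither [x] nor the vertex after [x], a return to
     the path closes a cycle of at least three vertices. *)
  have [y [yS exy ynh]] := other x (head x p) (sub x (mem_head _ _)).
  case: (boolP (y \in x :: p)) => [|yn].
    rewrite inE => /orP[/eqP yx|yp]; first by rewrite yx irr in exy.
    move: up pp sub ynh; case/splitPr: yp => p1 p2 up pp sub ynh.
    case: p1 => [|z p1] in up pp sub ynh *; first by rewrite /= eqxx in ynh.
    have : ~~ cycle e (x :: (z :: p1) ++ [:: y]).
      apply: acyc; last by rewrite /= size_cat /=; lia.
      move: up; rewrite -cat_cons -(cat1s y p2) catA cat_uniq => /andP[].
      by rewrite cat_cons.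
    rewrite /cycle rcons_path last_cat /= (sym y) exy andbT.
    by move: pp; rewrite /= !cat_path /= andbT => /and4P[-> -> ->].
  exists y, (x :: p); split => //.
  - by rewrite cons_uniq yn.
  - by rewrite /= (sym y) exy.
  - by move=> z; rewrite inE => /orP[/eqP ->|/sub].
  - by rewrite /= sz.
have [x [p [up _ sub sz]]] := long #|S|.
have := uniq_leq_size up (s2 := enum S).
rewrite -cardE /= sz ltnn => H; suff: false by [].
by apply: H => z /sub; rewrite mem_enum.
Qed.

(** The double sum counts each edge twice, so this is the forest bound: fewer edges than vertices.
    Induction removes a vertex of degree at most one. *)
Lemma acyclic_edge_bound (T : finType) (e : rel T) (S : {set T}) :
  symmetric e -> irreflexive e ->
  (forall c : seq T, uniq c -> (2 < size c)%N -> ~~ cycle e c) ->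
  S != set0 -> (\sum_(u in S) \sum_(v in S) e u v + 2 <= 2 * #|S|)%N.
Proof.
move=> sym irr acyc.
elim: {S}_.+1 {-2}S (ltnSn #|S|) => // m IH S ltS S0.
have [u uS du] := acyclic_low_degree sym irr acyc S0.
rewrite (bigD1 u) //=.
have -> : (\sum_(w in S | w != u) \sum_(v in S) e w v =
           \sum_(w in S | w != u) (e u w + \sum_(v in S :\ u) e w v))%N.
  apply: eq_bigr => w /andP[wS wu]; rewrite (bigD1 u) //= sym; congr (_ + _)%N.
  by apply: eq_bigl => v; rewrite !inE andbC.
rewrite big_split /=.
have -> : (\sum_(w in S | w != u) e u w = \sum_(w in S) e u w)%N.
  by rewrite [RHS](bigD1 u) //= irr.
have -> : (\sum_(w in S | w != u) \sum_(v in S :\ u) e w v =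
           \sum_(w in S :\ u) \sum_(v in S :\ u) e w v)%N.
  by apply: eq_bigl => w; rewrite !inE andbC.
have cS := cardsD1 u S; rewrite uS /= in cS.
case: (eqVneq (S :\ u) set0) => [S1|S1].
  have -> : (\sum_(v in S) e u v = 0)%N.
    rewrite (bigD1 u) //= irr big1 // => v /andP[vS vu].
    by have := in_set0 v; rewrite -S1 in_setD1 vu vS.
  by rewrite S1 big_set0; rewrite S1 cards0 in cS; lia.
have := IH (S :\ u); move=> /(_ _ S1); move: ltS cS du.
move: (\sum_(v in S) e u v)%N (\sum_(_ in _) _)%N #|S| #|S :\ u| => *; lia.
Qed.

(** Both conditions say that [r] has no cycle. Remove from [C] a vertex [v] without predecessor: a
    sink of the rest is still a sink of [C], for it has no arrow to [v]. *)
Lemma no_pred_no_succ (T : finType) (r : rel T) :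
  (forall C : {set T}, C != set0 -> exists2 v, v \in C & forall u, u \in C -> ~~ r u v) ->
  forall C : {set T}, C != set0 -> exists2 v, v \in C & forall u, u \in C -> ~~ r v u.
Proof.
move=> H C; elim: {C}_.+1 {-2}C (ltnSn #|C|) => // m IH C ltC C0.
have [v vC hv] := H C C0.
case: (eqVneq (C :\ v) set0) => [C1|C1].
  exists v => // u uC; case: (eqVneq u v) => [->|uv]; first exact: hv.
  by have := in_set0 u; rewrite -C1 in_setD1 uv uC.
have := cardsD1 v C; rewrite vC => cC.
have [|w] := IH (C :\ v) _ C1; first by lia.
rewrite !inE => /andP[wv wC] hw; exists w => // u uC.
by case: (eqVneq u v) => [->|uv]; [apply: hv | apply: hw; rewrite !inE uv].
Qed.

(** [P] is known on a growing set [C]; a sink of the complement has all its successors in [C] and is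
    added next. *)
Lemma acyclic_ind (T : finType) (r : rel T) (P : T -> Prop) :
  (forall C : {set T}, C != set0 -> exists2 v, v \in C & forall u, u \in C -> ~~ r v u) ->
  (forall v, (forall u, r v u -> P u) -> P v) -> forall v, P v.
Proof.
move=> acyc step.
suff H m (C : {set T}) : #|~: C| = m -> (forall v, v \in C -> P v) -> forall v, P v.
  by apply: (H _ set0 erefl) => v; rewrite inE.
elim: m C => [|m IH] C.
  move=> /eqP; rewrite cards_eq0 => /eqP C0 PC v; apply: PC.
  by have := in_set0 v; rewrite -C0 inE => /negbFE.
move=> cC PC; have [|v] := acyc (~: C); first by rewrite -card_gt0 cC.
rewrite inE => vC hv; apply: (IH (v |: C)).
  by have := cardsC (v |: C); have := cardsC C; rewrite cC cardsU1 vC; lia.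
move=> u; rewrite !inE => /orP[/eqP ->|]; last exact: PC.
apply: step => w rvw; apply: PC; apply: contraLR rvw => wC.
by apply: hv; rewrite inE.
Qed.

(** A simple path from [c] to [d] uses up the degree of each of its vertices, so no edge leaves it,
    and connectedness makes it exhaust the graph. *)
Lemma chain_of_degrees n (e : rel 'I_n) (c d : 'I_n) :
  symmetric e -> (forall u v, connect e u v) -> c != d ->
  (forall v, \sum_u e v u = 2 - (v == c) - (v == d))%N ->
  exists2 s, chain_order e s & (nth c s 0 = c) /\ (nth c s n.-1 = d).
Proof.
move=> sym conn cd deg.
have cardN v : #|[set u | e v u]| = (2 - (v == c) - (v == d))%N.
  by rewrite -deg -sum1_card big_mkcond; apply: eq_bigr => u _; rewrite inE; case: (e v u).
have /connectP[p0 pp0 dl0] := conn c d.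
have [p [pp up dl]] : exists p, [/\ path e c p, uniq (c :: p) & d = last c p].
  by rewrite dl0; case: (shortenP pp0) => p pp up _; exists p.
have p0' : p != [::] by apply: contra cd => /eqP pe; rewrite dl pe.
pose s := c :: p.
have szs : size s = (size p).+1 by [].
have szp : (0 < size p)%N by rewrite lt0n size_eq0.
have cons k : (k.+1 < size s)%N -> e (nth c s k) (nth c s k.+1).
  by move=> kp; have /pathP := pp => /(_ c k); apply.
have lastE : nth c s (size p) = d by rewrite dl -nth_last /=; case: (size p) szp.
have eqN k m : (k < size s)%N -> (m < size s)%N -> (nth c s k == nth c s m) = (k == m).
  by move=> *; apply: nth_uniq.
have single x u v : #|[set u | e x u]| = 1%N -> e x u -> e x v -> u == v.
  move=> /eqP/cards1P[w Nw] eu ev; have : u \in [set w] by rewrite -Nw inE.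
  by have : v \in [set w]; [rewrite -Nw inE | rewrite !inE => /eqP -> /eqP ->].
have nbr k v : (k < size s)%N -> e (nth c s k) v ->
    (0 < k)%N && (v == nth c s k.-1) || (k.+1 < size s)%N && (v == nth c s k.+1).
  move=> ks ev; have := cardN (nth c s k).
  have -> : (nth c s k == d) = (k == size p) by rewrite -lastE eqN.
  have -> : (nth c s k == c) = (k == 0)%N by apply: (eqN k 0%N).
  case: k => [|k] in ks ev *.
    rewrite eqxx (ltn_eqF szp) => N1.
    by rewrite /= ltnS szp; apply: (single c) => //; apply: (cons 0%N).
  have ek : e (nth c s k.+1) (nth c s k) by rewrite sym; apply: cons.
  rewrite /=; case: (ltnP k.+2 (size s)) => k2 /=.
    rewrite (ltn_eqF (_ : k.+1 < size p)%N); last by rewrite -ltnS -szs.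
    rewrite subn0 => cN.
    (* At an inner vertex of the path, [v] would be a third neighbour, against degree two. *)
    apply/negPn/negP; rewrite negb_or => /andP[v1 v2].
    have ek' := cons _ k2.
    have sub3 : [set v; nth c s k; nth c s k.+2] \subset [set u | e (nth c s k.+1) u].
      by apply/subsetP => u; rewrite !inE -orbA => /or3P[] /eqP ->.
    have := subset_leq_card sub3; rewrite cN cardsU cards2 v1 cards1.
    have -> : [set v; nth c s k] :&: [set nth c s k.+2] = set0.
      apply/setP => u; rewrite !inE; apply/negP => /andP[/orP[]/eqP -> ].
        by rewrite (negPf v2).
      by rewrite eqN //; first lia; exact: ltn_trans ks.
    by rewrite cards0.
  have -> : k.+1 == size p by lia.
  by rewrite orbF => N1; apply: single N1 _ _.
have all_s v : v \in s.
  have /connectP[q qp ->] := conn c v.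
  have := mem_head c p; rewrite -/s.
  elim: q (c) qp => {v} [|w q IH] u /=; first by [].
  move=> /andP[euw qp] us; apply: (IH _ qp).
  move: euw; rewrite -(nth_index c us) => /nbr.
  rewrite index_mem us => /(_ isT)/orP[]/andP[h /eqP ->]; apply: mem_nth => //.
  by rewrite (leq_ltn_trans (leq_pred _)) // index_mem.
have sz : size s = n.
  rewrite -[RHS]card_ord -(card_uniqP up); apply: eq_card => v.
  by rewrite all_s.
exists s; last by split=> //; have -> : n.-1 = size p by move: sz; rewrite szs; lia.
split=> // u v.
have [iu iv] : (index u s < size s)%N /\ (index v s < size s)%N by rewrite !index_mem !all_s.
have uE := nth_index c (all_s u); have vE := nth_index c (all_s v).
apply/idP/orP => [|[]/eqP E].
- move=> euv; have := nbr (index u s) v iu; rewrite uE => /(_ euv).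
  case/orP=> /andP[h /eqP ->]; rewrite index_uniq //.
  + by right; rewrite prednK // eqxx.
  + by rewrite (leq_ltn_trans (leq_pred _)).
  + by left.
- by rewrite -uE -vE -E; apply: cons; rewrite E.
- by rewrite sym -uE -vE -E; apply: cons; rewrite E.
Qed.

(** * Three-term recursions and continued fractions *)

(** The homogeneous system of the chain matrix: vertices sit at positions 1 to [n], and positions 0
    and [n.+1] hold boundary values. *)
Definition chain_rec (n : nat) (a x : nat -> int) : Prop :=
  forall k, (k < n)%N -> x k = a k.+1 * x k.+1 - x k.+2.

(** The outer coefficients of the recursion are units, so two consecutive values determine all the
    others integrally, in either direction. *)
Lemma chain_rec_dvd_up n a x m k : chain_rec n a x ->
  (m %| x 0%N)%Z -> (m %| x 1%N)%Z -> (k <= n.+1)%N -> (m %| x k)%Z.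
Proof.
move=> rec d0 d1; suff H j : (j <= n)%N -> (m %| x j)%Z && (m %| x j.+1)%Z.
  by case: k => [|k] // /H/andP[].
elim: j => [|j IH] jn; first by rewrite d0.
have /andP[dj dj1] := IH (ltnW jn); rewrite dj1 /=.
have -> : x j.+2 = a j.+1 * x j.+1 - x j by rewrite (rec j) //; ring.
by rewrite rpredB // dvdz_mull.
Qed.

Lemma chain_rec_dvd_down n a x m k : chain_rec n a x ->
  (m %| x n)%Z -> (m %| x n.+1)%Z -> (k <= n.+1)%N -> (m %| x k)%Z.
Proof.
move=> rec d0 d1; suff H j : (j <= n)%N -> (m %| x (n - j)%N)%Z && (m %| x (n - j).+1)%Z.
  rewrite leq_eqVlt ltnS => /orP[/eqP -> //|kn].
  by have := H (n - k)%N; rewrite leq_subr subKn // => /(_ isT)/andP[].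
elim: j => [|j IH] jn; first by rewrite subn0 d0.
have := IH (ltnW jn); rewrite -(subSS j n) subSn // => /andP[dj dj1].
rewrite dj andbT.
have -> : x (n - j.+1)%N = a (n - j.+1).+1 * x (n - j.+1).+1 - x (n - j.+1).+2.
  by apply: rec; rewrite ltn_subrL (leq_trans _ jn).
by rewrite rpredB //; apply: dvdz_mull.
Qed.

(** Read downwards from the zero at [n.+1], the sequence keeps the sign of [x n] and never moves
    back towards 0, because the coefficients are at least 2. The sign of [x 0] then decides that of
    [x n]. *)
Lemma chain_rec_mono n a x k : chain_rec n a x ->
  (forall k, (0 < k <= n)%N -> 2 <= a k) -> 0 < x 0%N -> x n.+1 = 0 ->
  (k <= n)%N -> 0 <= x k.+1 < x k.
Proof.
move=> rec a2 x0 xn kn.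
have neg j : x n <= 0 -> (j <= n)%N -> x (n - j)%N <= x (n - j).+1 <= 0.
  move=> xn0; elim: j => [|j IH] jn; first by rewrite subn0 xn xn0 /=.
  have := IH (ltnW jn); have -> : (n - j = (n - j.+1).+1)%N by lia.
  have := a2 (n - j.+1).+1; rewrite (rec (n - j.+1)%N); last by lia.
  move=> /(_ ltac:(lia)); nia.
have xn0 : 0 < x n.
  rewrite ltNge; apply/negP => /neg /(_ (leqnn n)); rewrite subnn; lia.
have pos j : (j <= n)%N -> 0 <= x (n - j).+1 < x (n - j)%N.
  elim: j => [|j IH] jn; first by rewrite subn0 xn xn0 /=.
  have := IH (ltnW jn); have -> : (n - j = (n - j.+1).+1)%N by lia.
  have := a2 (n - j.+1).+1; rewrite (rec (n - j.+1)%N); last by lia.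
  move=> /(_ ltac:(lia)); nia.
by have := pos (n - k)%N; rewrite leq_subr subKn //; apply.
Qed.

(** Dividing the recursion by [x k.+1] expresses [x k / x k.+1] as [a k.+1] minus the inverse of the
    next quotient; the final zero ends the fraction. *)
Lemma hj_value_chain_rec (a x : nat -> int) (j m : nat) :
  (forall k, (j <= k <= j + m)%N -> x k = a k.+1 * x k.+1 - x k.+2) ->
  (forall k, (j < k <= (j + m).+1)%N -> x k != 0) -> x (j + m).+2 = 0 ->
  hj_value [seq a k | k <- iota j.+1 m.+1] = (x j)%:~R / (x j.+1)%:~R.
Proof.
elim: m j => [|m IH] j rec nz xend.
  rewrite /= (rec j); last by lia.
  rewrite addn0 in xend; rewrite xend subr0 intrM mulfK // intr_eq0.
  by apply: nz; lia.
transitivity ((a j.+1)%:~R - (hj_value [seq a k | k <- iota j.+2 m.+1])^-1 : rat).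
  by [].
have E : (j.+1 + m = j + m.+1)%N by lia.
rewrite (IH j.+1); last first.
- by rewrite E.
- by move=> k; rewrite E => h; apply: nz; lia.
- by move=> k; rewrite E => h; apply: rec; lia.
have x1 : (x j.+1)%:~R != 0 :> rat by rewrite intr_eq0; apply: nz; lia.
rewrite invf_div (rec j); last by lia.
by rewrite intrB intrM; field.
Qed.

(** The point is [w = 1]. As [w] divides all [C k] and [D k], it divides [p], because some [q k] is
    1; for the same reason [p] is coprime to [q 1] and to [q n]. Since [w] also divides [q 1 * q n],
    it is a unit. *)
Lemma chain_rec_fraction (n k0 : nat) (a C D q : nat -> int) (p w : int) :
  (forall k, (0 < k <= n)%N -> 2 <= a k) -> 0 < p ->
  chain_rec n a C -> chain_rec n a D ->
  C 0%N = p ^+ 2 -> C n.+1 = 0 -> D 0%N = 0 -> D n.+1 = p ^+ 2 ->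
  C n = w -> D 1%N = w ->
  (forall k, (k <= n.+1)%N -> p * q k = C k + D k) -> q 1%N + q n = p ->
  (k0 <= n.+1)%N -> q k0 = 1 ->
  [/\ 0 < q 1%N < p, coprimez p (q 1%N), C 1%N = p * q 1%N - 1
    & forall k, (k <= n)%N -> 0 < C k].
Proof.
move=> a2 p0 recC recD C0 Cn1 D0 Dn1 Cn D1 qE qq k0n qk0.
have pn0 : p != 0 by rewrite gt_eqF.
have q0 : q 0%N = p by apply: (mulfI pn0); rewrite qE // C0 D0 addr0 expr2.
have qn1 : q n.+1 = p by apply: (mulfI pn0); rewrite qE // Cn1 Dn1 add0r expr2.
have recq : chain_rec n a q.
  move=> k kn; apply: (mulfI pn0); rewrite mulrBr mulrCA !qE; try lia.
  by rewrite (recC k) // (recD k) //; ring.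
have Cmono k := @chain_rec_mono n a C k recC a2.
have {}Cmono k : (k <= n)%N -> 0 <= C k.+1 < C k.
  by apply: Cmono => //; rewrite C0 exprn_gt0.
have Cpos k : (k <= n)%N -> 0 < C k by move=> /Cmono/andP[]; apply: le_lt_trans.
have w0 : 0 < w by rewrite -Cn Cpos.
have unit_dvd m : (forall k, (k <= n.+1)%N -> (m %| q k)%Z) -> (m %| 1)%Z.
  by move=> /(_ _ k0n); rewrite qk0.
have copI x y : (gcdz x y %| 1)%Z -> coprimez x y by rewrite dvdz1.
have wC k : (k <= n.+1)%N -> (w %| C k)%Z.
  by apply: (chain_rec_dvd_down recC); rewrite ?Cn ?Cn1 ?dvdz0 ?dvdzz.
have wD k : (k <= n.+1)%N -> (w %| D k)%Z.
  by apply: (chain_rec_dvd_up recD); rewrite ?D0 ?D1 ?dvdz0 ?dvdzz.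
have wp : (w %| p)%Z.
  by have := rpredD (wC _ k0n) (wD _ k0n); rewrite -qE // qk0 mulr1.
have cop1 : coprimez p (q 1%N).
  apply/copI/unit_dvd => k.
  by apply: (chain_rec_dvd_up recq); rewrite ?q0 ?dvdz_gcdl ?dvdz_gcdr.
have copn : coprimez p (q n).
  apply/copI/unit_dvd => k.
  by apply: (chain_rec_dvd_down recq); rewrite ?qn1 ?dvdz_gcdl ?dvdz_gcdr.
have C1 : C 1%N = p * q 1%N - w by rewrite qE // D1 addrK.
have Dn : D n = p * q n - w by rewrite qE // Cn addrC addKr.
have wqq : (w %| q 1%N * q n)%Z.
  (* [u] is built to vanish at [n] and to equal [p ^+ 2 * w] at [n.+1], so [p ^+ 2 * w] divides
     [u 1]. *)
  pose u k := w * D k - D n * C k.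
  have recu : chain_rec n a u by move=> k kn; rewrite /u (recC k) // (recD k) //; ring.
  have := @chain_rec_dvd_down n a u (p ^+ 2 * w) 1 recu.
  rewrite {1 2}/u Cn Cn1 Dn1 mulr0 subr0 [D n * w]mulrC subrr dvdz0.
  rewrite [w * _]mulrC dvdzz => /(_ isT isT isT).
  have -> : u 1%N = p ^+ 2 * (w - q 1%N * q n).
    rewrite /u D1 C1 Dn; by rewrite -qq; ring.
  rewrite dvdz_mul2l ?expf_neq0 //.
  by move=> /(rpredB (dvdzz w)); rewrite opprB addrC subrK.
have copw x : coprimez p x -> coprimez w x.
  move=> /eqP cx; apply: copI.
  have -> : 1%Z = gcdz p x by rewrite cx.
  by rewrite dvdz_gcd (dvdz_trans (dvdz_gcdl _ _) wp) dvdz_gcdr.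
have w1 : w = 1.
  have wqn : (w %| q n)%Z by rewrite -(Gauss_dvdzr _ (copw _ cop1)).
  have := copw _ copn; rewrite /coprimez; move/gcdz_idPl: wqn => ->.
  by move: w0; clear; lia.
have n0 : (0 < n)%N.
  rewrite lt0n; apply/eqP => nz; move: p0 qq q0 qn1; rewrite nz; clear; lia.
split=> //; last by rewrite C1 w1.
have q1 : 0 < q 1%N by have := Cpos 1%N n0; rewrite C1 w1; move: p0; clear; nia.
(* If [p <= q 1], then [C 1 < C 0] leaves only [q 1 = p]; coprimality gives [p = 1], and [C 1 = 0]
   contradicts positivity. *)
rewrite q1 ltNge /=; apply/negP => pq; have /andP[_] := Cmono 0%N isT.
rewrite C0 C1 w1 => lt; have qp : q 1%N = p by move: lt pq p0; clear; nia.
have := Cpos 1%N n0; have : p = 1; last by rewrite C1 qp w1 => ->.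
by move: cop1; rewrite qp /coprimez gcdzz; move: p0; clear; lia.
Qed.

(** * Scaled inverses and functions along a chain *)

(** Right multiplication by [A] kills [A *m B - p%:M]; the adjugate turns this into scaling by
    [\det A], which is nonzero. *)
Lemma mulmx_scalarC n (A B : 'M[int]_n) (p : int) : p != 0 ->
  B *m A = p%:M -> A *m B = p%:M.
Proof.
move=> p0 BA; have dA : \det A != 0.
  have : \det B * \det A = p ^+ n by rewrite -det_mulmx BA det_scalar.
  by apply: contra_eqN => /eqP ->; rewrite mulr0 eq_sym expf_neq0.
have E : (A *m B - p%:M) *m A = 0.
  by rewrite mulmxBl -mulmxA BA scalar_mxC subrr.
apply/eqP; rewrite -subr_eq0; apply/eqP.
have : (A *m B - p%:M) *m A *m \adj A = 0 by rewrite E mul0mx.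
rewrite -mulmxA mul_mx_adj mul_mx_scalar => /eqP.
by rewrite scalemx_eq0 (negPf dA) /= => /eqP.
Qed.

Lemma chain_order_mem n (e : rel 'I_n) s u : chain_order e s -> u \in s.
Proof.
case=> us sz _; apply: contraT => us'.
have := max_card (mem (u :: s)); rewrite (card_uniqP _) /= ?us' //.
by rewrite card_ord sz ltnn.
Qed.

Section ChainSequences.

Variables (n : nat) (e : rel 'I_n) (s : seq 'I_n) (c : 'I_n).
Hypothesis chain : chain_order e s.

(** Positions count from one; the zeros outside the chain make the neighbour sum uniform at its
    ends. *)
Definition along (x : 'I_n -> int) (k : nat) : int :=
  if (0 < k <= n)%N then x (nth c s k.-1) else 0.

Lemma along_neighbours x k : (k < n)%N ->
  \sum_u (e (nth c s k) u)%:R * x u = along x k + along x k.+2.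
Proof.
case: chain => us sz adj kn.
have ss : perm_eq (index_enum 'I_n) s.
  apply: uniq_perm; rewrite ?index_enum_uniq // => u; rewrite mem_index_enum.
  by rewrite (chain_order_mem _ chain).
rewrite (perm_big s) //= (big_nth c) big_mkord sz.
transitivity (\sum_(j < n) ((if (j.+1 == k)%N then x (nth c s j) else 0)
   + (if (j == k.+1 :> nat)%N then x (nth c s j) else 0))).
  apply: eq_bigr => j _; rewrite adj !index_uniq ?sz //.
  case: (eqVneq (nat_of_ord j) k.+1) => [->|jk].
    by rewrite /= mul1r gtn_eqF ?add0r // ltnW.
  rewrite /=; case: eqP => _; rewrite ?mul1r ?mul0r addr0 //.
rewrite big_split /=; congr (_ + _).
  rewrite -big_mkcond /along; case: k kn => [|k] kn.
    by rewrite big_pred0.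
  rewrite /= (ltnW kn) (big_pred1 (Ordinal (ltnW kn))) //.
rewrite -big_mkcond /along /=; case: ltnP => k1.
  by rewrite (big_pred1 (Ordinal k1)).
by rewrite big_pred0 // => j; apply: ltn_eqF; apply: leq_trans k1.
Qed.

End ChainSequences.

(** * Normal forms and the edge count by indices *)

Section NormalForms.

Variables (n : nat) (t t5 : 'I_n) (e r : rel 'I_n).

Definition head_coef (u i : 'I_n) : int :=
  if u == t then (if i == t5 then -2 else 0) else (u == i)%:R.

Definition coef (u i : 'I_n) : int := head_coef u i - (r u i)%:R.

Definition tails (S : {set 'I_n}) (i : 'I_n) := #|[set u in S | r u i]|.

(* Every row of an embedding has exactly one coefficient in {1, -2}; the others
   are 0 or -1.  After relabelling, vertex u <> t has its 1 at E_u, vertex t has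
   the -2 at E_t5, and r u i says that vertex u has coefficient -1 at E_i. *)
Record normal_form : Prop := NormalForm {
  nf_tree : is_tree e;
  nf_gram : forall u v, u != v -> \sum_i coef u i * coef v i = - (e u v)%:R;
  nf_neq : t5 != t;
  nf_col5 : forall u, r u t5 = false;
  nf_irr : forall u, u != t -> r u u = false;
  nf_colt : tails setT t = 2;
  nf_col : forall i, i != t -> i != t5 -> (0 < tails setT i <= 2)%N;
  nf_out : forall u, u != t -> exists i, r u i }.

Hypothesis nf : normal_form.

(** This is minus the sum of [coef u i * coef v i] over ordered pairs of distinct vertices of [S]:
    the share of [E_i] in twice the number of edges. *)
Definition contrib (S : {set 'I_n}) (i : 'I_n) : int :=
  \sum_(u in S) coef u i ^+ 2 - (\sum_(u in S) coef u i) ^+ 2.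

Lemma edges_contrib (S : {set 'I_n}) :
  (\sum_(u in S) \sum_(v in S) e u v)%N%:R = \sum_i contrib S i.
Proof.
have [_ _ irr _ _] := nf_tree nf.
transitivity (\sum_(u in S) (\sum_i coef u i ^+ 2 - \sum_(v in S) \sum_i coef u i * coef v i)).
  rewrite natr_sum; apply: eq_bigr => u uS.
  have -> : \sum_(v in S) \sum_i coef u i * coef v i =
            \sum_i coef u i ^+ 2 - \sum_(v in S) (e u v)%:R.
    rewrite (bigD1 u) //= [X in _ - X](bigD1 u) //= irr add0r -sumrN; congr (_ + _).
      by apply: eq_bigr => v /andP[_ vu]; rewrite nf_gram // eq_sym.
  by rewrite natr_sum opprB addrC subrK.
rewrite sumrB exchange_big /= /contrib sumrB; congr (_ - _).
under eq_bigr => u _ do rewrite exchange_big /=.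
rewrite exchange_big /=; apply: eq_bigr => i _.
by rewrite expr2 mulr_suml; apply: eq_bigr => u _; rewrite mulr_sumr.
Qed.

(** The head of a vertex and its coefficients -1 sit at different indices, so the squares add
    without a cross term. *)
Lemma contrib_head S i : contrib S i =
  \sum_(u in S) head_coef u i ^+ 2 + (tails S i)%:R
   - (\sum_(u in S) head_coef u i - (tails S i)%:R) ^+ 2.
Proof.
have tE : (tails S i)%:R = \sum_(u in S) (r u i)%:R :> int.
  rewrite /tails -sum1_card natr_sum big_mkcond [RHS]big_mkcond /=.
  by apply: eq_bigr => u _; rewrite inE; case: (u \in S); case: (r u i).
rewrite /contrib sumrB -tE; congr (_ - _); rewrite tE -big_split /=.
apply: eq_bigr => u _; rewrite /coef /head_coef.
case: (eqVneq u t) => ut.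
  by case: (eqVneq i t5) => [->|_]; rewrite ?nf_col5 //; case: (r u i).
by case: (eqVneq u i) => [<-|_]; rewrite ?nf_irr //; case: (r u i).
Qed.

Lemma contrib_t S : contrib S t = (tails S t)%:R - (tails S t)%:R ^+ 2.
Proof.
have h0 u : head_coef u t = 0.
  by rewrite /head_coef eq_sym [t == t5]eq_sym (negPf (nf_neq nf)); case: eqVneq.
rewrite contrib_head !big1 ?add0r ?sub0r ?sqrrN // => u _; by rewrite h0 ?expr0n.
Qed.

Lemma tails_t5 S : tails S t5 = 0%N.
Proof. by apply/eqP; rewrite cards_eq0; apply/eqP/setP => u; rewrite !inE nf_col5 // andbF. Qed.

(** The column consists of -2 and 1, and [5 - 1 = 4]. *)
Lemma contrib_t5 (S : {set 'I_n}) : t \in S -> t5 \in S -> contrib S t5 = 4.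
Proof.
move=> tS t5S; rewrite contrib_head tails_t5.
have sum2 (F : 'I_n -> int) : (forall u, u != t -> u != t5 -> F u = 0) ->
    \sum_(u in S) F u = F t + F t5.
  move=> F0.
  have h5 : (t5 \in S) && (t5 != t) by rewrite t5S (nf_neq nf).
  rewrite (bigD1 t tS) /= (bigD1 t5 h5) /=; congr (_ + _).
  by rewrite big1 ?addr0 // => u /andP[/andP[_ ut] u5]; apply: F0.
have h0 u : u != t -> u != t5 -> head_coef u t5 = 0.
  by rewrite /head_coef => /negPf -> /negPf ->.
rewrite !sum2 => [|u ut u5|//]; last by rewrite h0.
by rewrite /head_coef !eqxx (negPf (nf_neq nf)).
Qed.

Lemma contrib_t5_out (S : {set 'I_n}) : t \notin S -> t5 \notin S -> contrib S t5 = 0.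
Proof.
move=> tS t5S; rewrite contrib_head tails_t5.
have h0 u : u \in S -> head_coef u t5 = 0.
  rewrite /head_coef; case: (eqVneq u t) => [-> /(negP tS) //|_ uS].
  by case: (eqVneq u t5) => [u5|//]; rewrite -u5 uS in t5S.
by rewrite !big1 => [//|u /h0 ->|u /h0 ->].
Qed.

(** For 0, 1, 2 tails the value is 0, 2, 2 if [i] lies in [S], and 0, 0, -2 otherwise. The edge
    bound compares this with 2 per vertex. *)
Lemma contrib_other (S : {set 'I_n}) i : i != t -> i != t5 ->
  contrib S i = (i \in S)%:R + (tails S i)%:R - ((i \in S)%:R - (tails S i)%:R) ^+ 2.
Proof.
move=> it i5.
have hE u : head_coef u i = (u == i)%:R.
  rewrite /head_coef (negPf i5).
  by case: (eqVneq u t) => [->|//]; rewrite eq_sym (negPf it).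
rewrite contrib_head.
have sE : \sum_(u in S) head_coef u i = (i \in S)%:R.
  rewrite big_mkcond (bigD1 i) //= hE eqxx big1 ?addr0; first by case: ifP.
  by move=> u /negPf ui; rewrite hE ui; case: ifP.
rewrite sE; congr (_ + _ - _); rewrite -sE; apply: eq_bigr => u _.
by rewrite hE; case: (u == i).
Qed.

Lemma tails_le2 S i : (tails S i <= 2)%N.
Proof.
have mono : (tails S i <= tails setT i)%N.
  by apply/subset_leq_card/subsetP => u; rewrite !inE => /andP[_ ->].
apply: leq_trans mono _; case: (eqVneq i t) => [->|it]; first by rewrite nf_colt.
case: (eqVneq i t5) => [->|i5]; first by rewrite tails_t5.
by have /andP[] := nf_col nf it i5.
Qed.

Lemma contrib_bound (S : {set 'I_n}) : S != set0 ->
  \sum_i contrib S i < 2 * #|S|%:R.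
Proof.
move=> S0; have [_ sym irr _ acyc] := nf_tree nf.
have := acyclic_edge_bound sym irr acyc S0; rewrite -edges_contrib !natz.
by move: (\sum_(u in S) \sum_(v in S) e u v)%N #|S| => a b; lia.
Qed.

Lemma card_sum (S : {set 'I_n}) : #|S|%:R = \sum_i (i \in S)%:R :> int.
Proof.
by rewrite -sum1_card natr_sum big_mkcond; apply: eq_bigr => i _; case: (i \in S).
Qed.

Lemma tails_split B i : tails setT i = (tails B i + tails (~: B) i)%N.
Proof.
rewrite /tails -cardsUI [X in (_ + #|pred_of_set X|)%N](_ : _ = set0); last first.
  by apply/setP => u; rewrite !inE; case: (u \in B); rewrite //= andbF.
rewrite cards0 addn0; apply: eq_card => u; rewrite !inE.
by case: (u \in B); rewrite //= orbF.
Qed.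

(* The complement of B would span as many edges as it has vertices. *)
Lemma forward_closed_misses_t (B : {set 'I_n}) :
  t \notin B -> t5 \notin B ->
  (forall u i, u \in B -> i != t -> r u i -> i \in B) ->
  (forall i, i \in B -> (tails (~: B) i <= 1)%N) ->
  forall u, u \in B -> r u t = false.
Proof.
move=> tB t5B fwd tl u uB; apply/negP => rut.
have tP : t \in ~: B by rewrite inE.
have t5P : t5 \in ~: B by rewrite inE.
have : \sum_i contrib (~: B) i < 2 * #|~: B|%:R.
  by apply: contrib_bound; apply/set0Pn; exists t.
apply/negP; rewrite -leNgt card_sum.
rewrite (bigD1 t) // (bigD1 t5) ?nf_neq //= [in leRHS](bigD1 t) // [in leRHS](bigD1 t5) ?nf_neq //=.
rewrite contrib_t5 // contrib_t tP t5P.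
have tt : (tails (~: B) t <= 1)%N.
  have := tails_split B t; rewrite nf_colt //.
  suff : (0 < tails B t)%N by lia.
  by apply/card_gt0P; exists u; rewrite inE uB.
(* An index in [B] has at most one tail outside [B] and contributes 0; an index outside [B] keeps
   its one or two tails and contributes 2. With 0 from [t] and 4 from [t5], the complement reaches 2
   per vertex. *)
have le : 2 * \sum_(i < n | (i != t) && (i != t5)) (i \in ~: B)%:R <=
    \sum_(i < n | (i != t) && (i != t5)) contrib (~: B) i :> int.
  rewrite mulr_sumr; apply: ler_sum => i /andP[it i5].
  rewrite contrib_other //; case: (boolP (i \in B)) => iB.
    have := tl i iB; rewrite inE iB /=.
    by case: (tails _ i) => [|[|]].
  have t0 : tails B i = 0%N.
    apply/eqP; rewrite cards_eq0; apply/eqP/setP => v; rewrite !inE.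
    apply/negP => /andP[vB rvi]; move/negP: iB; apply; exact: fwd rvi.
  have := tails_split B i; rewrite t0 add0n => <-.
  rewrite inE iB /=; have := nf_col nf it i5.
  by case: (tails _ i) => [|[|[|]]].
move: (\sum_(i < n | _) (i \in ~: B)%:R) (\sum_(i < n | _) contrib _ _) le => x y le.
by move: tt; case: (tails (~: B) t) => [|[|m]] //= _; rewrite mulr1n; lia.
Qed.

(** * Acyclicity of the arcs and exclusion of type (4) *)

(** [E_t] carries no head, since the head of vertex [t] is at [E_t5]; a coefficient -1 at [E_t]
    therefore points to no vertex. *)
Definition arc : rel 'I_n := fun u i => (i != t) && r u i.

Lemma pred_in_closure (A : {set 'I_n}) v :
  v \notin A -> [exists u in A, connect arc u v] ->
  exists u, [exists w in A, connect arc w u] && arc u v.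
Proof.
move=> vA /exists_inP[w wA /connectP[p]].
case/lastP: p => [|p y] /=; first by move=> _ vw; rewrite vw wA in vA.
rewrite rcons_path last_rcons => /andP[pp ay] vy; exists (last w p).
rewrite vy ay andbT; apply/exists_inP; exists w => //.
by apply/connectP; exists p.
Qed.

Lemma arc_closure_fwd (A : {set 'I_n}) u v :
  [exists w in A, connect arc w u] -> arc u v -> [exists w in A, connect arc w v].
Proof.
move=> /exists_inP[w wA cw] uv; apply/exists_inP; exists w => //.
exact: connect_trans cw (connect1 uv).
Qed.

(** Otherwise every vertex of the forward closure [B] of [C] has a predecessor in [B]. Then [B]
    avoids [t] and [t5], no vertex of [B] meets [E_t], and [B] spans too many edges. *)
Lemma arc_pred_acyclic (C : {set 'I_n}) : C != set0 ->
  exists2 v, v \in C & forall u, u \in C -> ~~ arc u v.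
Proof.
move=> C0; suff /exists_inP[v vC /forall_inP h] :
  [exists v in C, [forall u in C, ~~ arc u v]] by exists v.
apply: contraT => /exists_inPn Hn.
have hC v : v \in C -> exists2 u, u \in C & arc u v.
  by move=> /Hn /forall_inPn[u uC /negbNE]; exists u.
pose B := [set v | [exists u in C, connect arc u v]].
have hB v : v \in B -> exists2 u, u \in B & arc u v.
  rewrite inE; case: (boolP (v \in C)) => [/hC[u uC uv] _|vC /(pred_in_closure vC)[u /andP[uB uv]]].
    by exists u => //; rewrite inE; apply/exists_inP; exists u.
  by exists u => //; rewrite inE.
have tB : t \notin B by apply/negP => /hB[u _]; rewrite /arc eqxx.
have t5B : t5 \notin B by apply/negP => /hB[u _]; rewrite /arc nf_col5 // andbF.
have fwd u i : u \in B -> i != t -> r u i -> i \in B.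
  by rewrite !inE => uB it ri; apply: arc_closure_fwd uB _; rewrite /arc it.
have tlB i : i \in B -> (0 < tails B i)%N.
  move=> /hB[u uB /andP[_ ui]]; apply/card_gt0P; exists u; by rewrite inE uB.
have noT : forall u, u \in B -> r u t = false.
  apply: forward_closed_misses_t => // i iB.
  have := tails_le2 setT i; have := tlB i iB; rewrite (tails_split B i); lia.
have B0 : B != set0.
  case/set0Pn: C0 => v vC; apply/set0Pn; exists v; rewrite inE.
  by apply/exists_inP; exists v.
(* Each index in [B] has one or two tails in [B] and contributes 2; all others contribute 0. *)
have := contrib_bound B0; apply: contraLR => _; rewrite -leNgt card_sum.
rewrite mulr_sumr; apply: ler_sum => i _.
case: (eqVneq i t) => [->|it].
  rewrite contrib_t (negPf tB) /tails (_ : [set u in B | r u t] = set0) ?cards0 //.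
  by apply/setP => u; rewrite !inE; apply/negP => /andP[uB]; rewrite noT // inE.
case: (eqVneq i t5) => [->|i5]; first by rewrite contrib_t5_out // (negPf t5B).
rewrite contrib_other //; case: (boolP (i \in B)) => iB.
  by have := tlB i iB; have := tails_le2 B i; case: (tails B i) => [|[|[|]]].
rewrite /tails (_ : [set u in B | r u i] = set0) ?cards0 //.
apply/setP => u; rewrite !inE; apply/negP => /andP[uB ui].
by move/negP: iB; apply; apply: fwd ui; rewrite // inE.
Qed.

Lemma arc_succ_acyclic (C : {set 'I_n}) : C != set0 ->
  exists2 v, v \in C & forall u, u \in C -> ~~ arc v u.
Proof. by apply: no_pred_no_succ => D; apply: arc_pred_acyclic. Qed.

(** If [i] had a single tail, its forward closure [B] would not meet [E_t]. But a sink of [B] has a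
    coefficient -1 somewhere, and neither [B] nor [E_t] can receive it. *)
Lemma tails_setT i : i != t5 -> tails setT i = 2.
Proof.
move=> i5; case: (eqVneq i t) => [->|it]; first exact: nf_colt.
have /andP[t0 t2] := nf_col nf it i5; apply/eqP; rewrite eqn_leq t2 ltnNge.
apply/negP => t1.
pose B := [set v | [exists u in [set i], connect arc u v]].
have iB : i \in B by rewrite inE; apply/exists_inP; exists i; rewrite ?inE.
have hB v : v \in B -> v != i -> exists2 u, u \in B & arc u v.
  rewrite inE => vB vi; have [|u /andP[uB uv]] := pred_in_closure _ vB.
    by rewrite inE.
  by exists u => //; rewrite inE.
have tB : t \notin B by apply/negP => /hB[|u _]; rewrite 1?eq_sym // /arc eqxx.
have t5B : t5 \notin B.
  by apply/negP => /hB[|u _]; rewrite 1?eq_sym // /arc nf_col5 // andbF.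
have fwd u j : u \in B -> j != t -> r u j -> j \in B.
  by rewrite !inE => uB jt rj; apply: arc_closure_fwd uB _; rewrite /arc jt.
have noT : forall u, u \in B -> r u t = false.
  apply: forward_closed_misses_t => // j jB.
  have := tails_split B j; case: (eqVneq j i) => [->|ji]; first by lia.
  have [u uB /andP[_ uj]] := hB j jB ji.
  have : (0 < tails B j)%N by apply/card_gt0P; exists u; rewrite inE uB.
  by have := tails_le2 setT j; lia.
have [|v vB vout] := arc_succ_acyclic (C := B); first by apply/set0Pn; exists i.
have vt : v != t by apply: contraNneq tB => <-.
have [j rvj] := nf_out nf vt.
case: (eqVneq j t) => [jt|jt]; first by rewrite jt noT in rvj.
by have := vout j (fwd _ _ vB jt rvj); rewrite /arc jt rvj.
Qed.

(** * Adjunction, degrees and the inverse of the coefficient matrix *)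

Definition weight (v : 'I_n) : int := \sum_i coef v i ^+ 2.

Lemma coef_t v : coef v t = - (r v t)%:R.
Proof.
rewrite /coef /head_coef eq_sym [t == t5]eq_sym (negPf (nf_neq nf)).
by case: eqVneq; rewrite sub0r.
Qed.

Lemma coef_other v i : v != t -> coef v i = (v == i)%:R - (r v i)%:R.
Proof. by rewrite /coef /head_coef => /negPf ->. Qed.

Lemma coef_bottom i : coef t i = - 2 * (i == t5)%:R - (r t i)%:R.
Proof. by rewrite /coef /head_coef eqxx; case: (i == t5); rewrite ?mulr1 ?mulr0. Qed.

Lemma weight_ge2 v : 2 <= weight v.
Proof.
rewrite /weight; case: (eqVneq v t) => [->|vt].
  rewrite (bigD1 t5) //= coef_bottom eqxx (nf_col5 nf).
  by rewrite -[2]addr0 lerD ?sumr_ge0 // => i _; apply: sqr_ge0.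
have [j rj] := nf_out nf vt.
have jv : j != v by apply: contraTneq rj => ->; rewrite (nf_irr nf).
rewrite (bigD1 v) //= (bigD1 j) //= !coef_other // eqxx (nf_irr nf) // rj.
rewrite [v == j]eq_sym (negPf jv) addrA -[2]addr0 lerD ?sumr_ge0 //.
by move=> i _; apply: sqr_ge0.
Qed.

(** [x ^+ 2 + x] vanishes at 0 and -1 and equals 2 at 1 and -2, so only the head counts. *)
Lemma adjunction v : \sum_i (coef v i ^+ 2 + coef v i) = 2.
Proof.
transitivity (\sum_i (head_coef v i ^+ 2 + head_coef v i)).
  apply: eq_bigr => i _; rewrite /coef /head_coef.
  case: (eqVneq v t) => vt.
    by case: (eqVneq i t5) => [->|_]; rewrite ?(nf_col5 nf) //; case: (r v i).
  by case: (eqVneq v i) => [<-|_]; rewrite ?(nf_irr nf) //; case: (r v i).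
rewrite /head_coef; case: (eqVneq v t) => vt.
  by rewrite (bigD1 t5) //= eqxx big1 ?addr0 // => i /negPf ->.
by rewrite (bigD1 v) //= eqxx big1 ?addr0 // => i; rewrite eq_sym => /negPf ->.
Qed.

(** Columns add up as [1 - 1 - 1], as [1 - 2] at [t5], and as [-1 - 1] at [t]: the sum of all
    vertices is [- (K + E_t)]. *)
Lemma column_sum i : \sum_u coef u i = -1 - (i == t)%:R.
Proof.
rewrite sumrB.
have -> : \sum_u (r u i)%:R = (tails setT i)%:R :> int.
  rewrite /tails -sum1_card natr_sum [RHS]big_mkcond /=.
  by apply: eq_bigr => u _; rewrite !inE; case: (r u i).
have -> : \sum_u head_coef u i = 1 - 2 * (i == t5)%:R - (i == t)%:R.
  rewrite (bigD1 t) //= {1}/head_coef eqxx.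
  rewrite (eq_bigr (fun u => (u == i)%:R)); last first.
    by move=> u; rewrite /head_coef => /negPf ->.
  case: (eqVneq i t) => [->|it].
    rewrite eq_sym (negPf (nf_neq nf)) big1 ?addr0 // => u /negPf -> //.
  rewrite (bigD1 i) //= eqxx big1 => [|u /andP[_ /negPf -> //]].
  by case: (i == t5).
case: (eqVneq i t5) => [->|i5]; last by rewrite tails_setT //=; ring.
by rewrite tails_t5 (negPf (nf_neq nf)) /=; ring.
Qed.

Lemma gram v u : \sum_i coef v i * coef u i = if v == u then weight v else - (e v u)%:R.
Proof.
case: eqVneq => [<-|]; last exact: (nf_gram nf).
by apply: eq_bigr => i _; rewrite expr2.
Qed.

(** Pair [v] with the sum of all vertices, [- (K + E_t)], and cancel the square of [v] by
    adjunction. *)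
Lemma degree v : (\sum_u e v u)%N%:R = 2 - (r v t)%:R :> int.
Proof.
have [_ _ irr _ _] := nf_tree nf.
have E : \sum_u \sum_i coef v i * coef u i = weight v - (\sum_u e v u)%N%:R.
  rewrite (bigD1 v) //= gram eqxx [in RHS](bigD1 v) //= irr add0n natr_sum -sumrN.
  by congr (_ + _); apply: eq_bigr => u uv; rewrite gram eq_sym (negPf uv).
have : \sum_u \sum_i coef v i * coef u i = \sum_i coef v i * (-1 - (i == t)%:R).
  rewrite exchange_big; apply: eq_bigr => i _.
  by rewrite -mulr_sumr column_sum.
rewrite E; have -> : \sum_i coef v i * (-1 - (i == t)%:R) = - \sum_i coef v i - coef v t.
  rewrite -sumrN (bigD1 t) //= [in RHS](bigD1 t) //= eqxx.
  rewrite (eq_bigr (fun i => - coef v i)); last first.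
    by move=> i /negPf ->; rewrite subr0 mulrN1.
  by rewrite /=; ring.
have := adjunction v; rewrite big_split /= -/(weight v) coef_t; lra.
Qed.

(* Up to a combination of the vertices other than t, E_i is a positive multiple of E_t. *)
Lemma basis_reduction i : exists w : ('I_n -> int) * int,
  [/\ w.1 t = 0, 0 < w.2 &
    forall j, \sum_u w.1 u * coef u j + w.2 * (j == t)%:R = (j == i)%:R].
Proof.
move: i; apply: (acyclic_ind arc_succ_acyclic) => i IH.
case: (eqVneq i t) => [->|it].
  exists (fun _ => 0, 1); split => // j.
  by rewrite big1 ?add0r ?mul1r // => u _; rewrite mul0r.
have good j : exists w : ('I_n -> int) * int, r i j ->
    [/\ w.1 t = 0, 0 < w.2 &
    forall k, \sum_u w.1 u * coef u k + w.2 * (k == t)%:R = (k == j)%:R].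
  case: (boolP (r i j)) => rij; last by exists (fun _ => 0, 0).
  case: (eqVneq j t) => [->|jt].
    exists (fun _ => 0, 1) => _; split => // k.
    by rewrite big1 ?add0r ?mul1r // => u _; rewrite mul0r.
  by have [|w Hw] := IH j; [rewrite /arc jt | exists w].
have [f Hf] := fin_all_exists good.
(* Row [i] is [E_i] minus the [E_j] with [r i j], so [E_i] is this row plus the reductions of those
   [E_j]. *)
exists (fun u => (u == i)%:R + \sum_(j | r i j) (f j).1 u, \sum_(j | r i j) (f j).2).
split=> [||k] /=.
- rewrite eq_sym (negPf it) add0r big1 // => j /Hf[-> //].
- have [j rij] := nf_out nf it; rewrite (bigD1 j) //=.
  rewrite ltr_wpDr //; first by apply: sumr_ge0 => l /andP[/Hf[_ /ltW]].
  by have [] := Hf j rij.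
rewrite (eq_bigr (fun u => (u == i)%:R * coef u k + \sum_(j | r i j) (f j).1 u * coef u k)); last first.
  by move=> u _; rewrite mulrDl mulr_suml.
rewrite big_split /= (bigD1 i) //= eqxx mul1r [X in _ + X + _ + _]big1 ?addr0; last first.
  by move=> u /negPf ->; rewrite mul0r.
rewrite exchange_big /= mulr_suml -addrA -big_split /=.
rewrite (eq_bigr (fun j => (k == j)%:R)) => [|j /Hf[_ _ ->] //].
rewrite coef_other // big_mkcond (bigD1 k) //= eqxx big1 => [|j /negPf jk]; last first.
  by rewrite eq_sym jk; case: ifP.
by rewrite eq_sym; case: (r i k); rewrite ?addr0 ?subr0 ?subrK.
Qed.

(** Row [t] is [- 2 E_t5] minus the [E_j] with [r t j]; reducing these leaves [- p E_t]. Hence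
    [p E_t] is an integral combination of rows with coefficient -1 at row [t]. *)
Lemma scaled_inverse : exists (p : int) (B : 'M[int]_n),
  [/\ 0 < p, B *m (\matrix_(u, j) coef u j) = p%:M & B t t = -1].
Proof.
have [f Hf] := fin_all_exists basis_reduction.
pose p := 2 * (f t5).2 + \sum_(j | r t j) (f j).2.
have p0 : 0 < p.
  rewrite ltr_wpDr //; first by apply: sumr_ge0 => j _; have [_ /ltW] := Hf j.
  by rewrite mulr_gt0 //; have [] := Hf t5.
pose b u := - (2 * (f t5).1 u + \sum_(j | r t j) (f j).1 u) - (u == t)%:R.
have bt : b t = -1.
  rewrite /b eqxx; have [-> _ _] := Hf t5.
  by rewrite big1 => [|j _]; [rewrite mulr0 addr0 oppr0 sub0r | have [-> _ _] := Hf j].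
have bE k : \sum_u b u * coef u k = p * (k == t)%:R.
  rewrite (eq_bigr (fun u => - 2 * ((f t5).1 u * coef u k) -
    \sum_(j | r t j) (f j).1 u * coef u k - (u == t)%:R * coef u k)); last first.
    by move=> u _; rewrite -mulr_suml /b; ring.
  rewrite !sumrB -mulr_sumr exchange_big /= [X in _ - X](bigD1 t) //= eqxx mul1r.
  rewrite [X in _ - (_ + X)]big1 ?addr0; last by move=> u /negPf ->; rewrite mul0r.
  have [_ _ /(_ k) E5] := Hf t5; rewrite -[\sum_u _ * _](addrK ((f t5).2 * (k == t)%:R)) E5.
  rewrite (eq_bigr (fun j => (k == j)%:R - (f j).2 * (k == t)%:R)); last first.
    by move=> j _; have [_ _ <-] := Hf j; rewrite addrK.
  rewrite sumrB -mulr_suml coef_bottom /p.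
  have -> : \sum_(j | r t j) (k == j)%:R = (r t k)%:R :> int.
    rewrite big_mkcond (bigD1 k) //= eqxx big1 => [|j /negPf jk]; last first.
      by rewrite eq_sym jk; case: ifP.
    by case: (r t k).
  by ring.
(* For [i != t], scale the reduction of [E_i] by [p] and replace [p E_t] by the combination [b]. *)
exists p, (\matrix_(i, u) if i == t then b u else p * (f i).1 u + (f i).2 * b u).
split=> //; last by rewrite mxE eqxx.
apply/matrixP => i k; rewrite !mxE.
case: (eqVneq i t) => [->|it].
  rewrite (eq_bigr (fun u => b u * coef u k)) => [|u _]; last by rewrite !mxE eqxx.
  by rewrite bE -[RHS]mulr_natr eq_sym.
rewrite (eq_bigr (fun u => p * ((f i).1 u * coef u k) + (f i).2 * (b u * coef u k))); last first.
  by move=> u _; rewrite !mxE (negPf it); ring.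
rewrite big_split /= -!mulr_sumr bE; have [_ _ /(_ k) Ei] := Hf i.
rewrite -[RHS]mulr_natr [i == k]eq_sym -Ei; ring.
Qed.

(** * The chain of a normal form and its continued fraction *)

Lemma normal_form_chain : exists (p q : nat) (s : seq 'I_n),
  [/\ coprime p q /\ (0 < q < p)%N, chain_order e s &
    hj_value [seq weight v | v <- s] = (p ^ 2)%:R / (p * q - 1)%:R].
Proof.
have [_ sym irr conn _] := nf_tree nf.
have [c [d [cd tE]]] : exists c d, c != d /\ forall u, r u t = (u == c) || (u == d).
  have /eqP/cards2P[c [d [cd E]]] := nf_colt nf; exists c, d; split=> [|u] //.
  by have : (u \in [set c; d]) = r u t; [rewrite -E !inE | rewrite !inE].
have deg v : (\sum_u e v u = 2 - (v == c) - (v == d))%N.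
  have := degree v; rewrite tE => H; apply/eqP; rewrite -(eqr_nat int) H.
  by case: (eqVneq v c) => [->|vc]; rewrite ?(negPf cd) /=; [|case: (v == d)].
have [s chain [s0 sn]] := chain_of_degrees sym conn cd deg.
have [us sz adj] := chain.
have [p [B [p0 BA Btt]]] := scaled_inverse.
set A := (\matrix_(u, j) coef u j) in BA.
have AB := mulmx_scalarC (lt0r_neq0 p0) BA.
pose W := B^T *m B.
have TW : A *m A^T *m W = (p ^+ 2)%:M.
  rewrite /W -mulmxA (mulmxA A^T) -trmx_mul BA tr_scalar_mx mul_scalar_mx.
  by rewrite -scalemxAr AB scale_scalar_mx expr2.
have WE v k : weight v * W v k - \sum_u (e v u)%:R * W u k = p ^+ 2 * (v == k)%:R.
  have <- : (A *m A^T *m W) v k = p ^+ 2 * (v == k)%:R by rewrite TW mxE mulr_natr.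
  have AAT u : (A *m A^T) v u = if v == u then weight v else - (e v u)%:R.
    by rewrite -gram mxE; apply: eq_bigr => i _; rewrite !mxE.
  rewrite [in RHS]mxE [in RHS](bigD1 v) //= [in LHS](bigD1 v) //= irr mul0r add0r AAT eqxx -sumrN.
  congr (_ + _); apply: eq_bigr => u uv.
  by rewrite AAT eq_sym (negPf uv) mulNr.
(* Column [t] of [A] is -1 at [c] and [d] and 0 elsewhere. *)
have Bcd i : B i c + B i d = - (p * (i == t)%:R).
  have <- : (B *m A) i t = p * (i == t)%:R by rewrite BA mxE mulr_natr.
  rewrite mxE.
  rewrite (eq_bigr (fun u => - (B i u * (r u t)%:R))) => [|u _]; last first.
    by rewrite mxE coef_t mulrN.
  rewrite (bigD1 c) //= (bigD1 d) 1?eq_sym //= !tE !eqxx orbT big1 ?addr0.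
    by rewrite !mulr1 opprD !opprK.
  by move=> u /andP[/negPf uc /negPf ud]; rewrite tE uc ud mulr0 oppr0.
have Wcd k : W k c + W k d = p * - B t k.
  rewrite !mxE -big_split /= (bigD1 t) //= big1 ?addr0.
    by rewrite !mxE -mulrDr Bcd eqxx mulr1 mulrN mulrC mulrN.
  by move=> i it; rewrite !mxE -mulrDr Bcd (negPf it) mulr0 oppr0 mulr0.
have n0 : (0 < n)%N by apply: leq_ltn_trans (ltn_ord c).
pose nd k := nth c s k.
have ndE k l : (k < n)%N -> (l < n)%N -> (nd k == nd l) = (k == l).
  by move=> kn ln; apply: nth_uniq; rewrite ?sz.
pose a k := weight (nd k.-1).
(* The source term [p ^+ 2] of each column sits at an end of the chain, so it becomes a boundary
   value: at 0 for [c], at [n.+1] for [d]. Both recursions are then homogeneous. *)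
pose C k := along s c (W ^~ c) k + p ^+ 2 * (k == 0)%N%:R.
pose D k := along s c (W ^~ d) k + p ^+ 2 * (k == n.+1)%N%:R.
(* The boundary values [p] are forced by [p * q k = C k + D k]. *)
pose q k := if (k == 0)%N || (k == n.+1)%N then p else - B t (nd k.-1).
have a2 k : (0 < k <= n)%N -> 2 <= a k by move=> _; apply: weight_ge2.
have ndc k : (k < n)%N -> (nd k == c) = (k == 0)%N.
  by move=> kn; rewrite -[X in _ == X]s0 ndE.
have ndd k : (k < n)%N -> (nd k == d) = (k == n.-1)%N.
  by move=> kn; rewrite -[X in _ == X]sn ndE // ltn_predL.
have along1 x k : (k < n)%N -> along s c x k.+1 = x (nd k) by rewrite /along /= => ->.
have along0 x : along s c x 0%N = 0 by [].
have alongn x : along s c x n.+1 = 0 by rewrite /along ltnn.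
have recC : chain_rec n a C.
  move=> k kn; have := WE (nd k) c; rewrite (along_neighbours c chain (W ^~ c)) //.
  rewrite /C (along1 _ k kn) (ndc _ kn) /a /= => <-.
  by rewrite mulr0 addr0; ring.
have recD : chain_rec n a D.
  move=> k kn; have := WE (nd k) d; rewrite (along_neighbours c chain (W ^~ d)) //.
  rewrite /D (along1 _ k kn) (ndd _ kn) /a /= !eqSS (ltn_eqF kn) (ltn_eqF (leqW kn)).
  have -> : (k.+1 == n) = (k == n.-1) by rewrite -[n in LHS](prednK n0) eqSS.
  by move=> <-; rewrite mulr0 !addr0; ring.
have C0 : C 0%N = p ^+ 2 by rewrite /C along0 eqxx mulr1 add0r.
have Cn1 : C n.+1 = 0 by rewrite /C alongn mulr0 addr0.
have D0 : D 0%N = 0 by rewrite /D along0 mulr0 addr0.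
have Dn1 : D n.+1 = p ^+ 2 by rewrite /D alongn eqxx mulr1 add0r.
have Cn : C n = W d c.
  by rewrite /C /along n0 leqnn /= sn gtn_eqF // mulr0 addr0.
have D1 : D 1%N = W d c.
  rewrite /D along1 // /nd s0 eqSS (ltn_eqF n0) mulr0 addr0.
  by rewrite !mxE; apply: eq_bigr => i _; rewrite !mxE mulrC.
have qE k : (k <= n.+1)%N -> p * q k = C k + D k.
  case: k => [_|k]; first by rewrite C0 D0 addr0 /q eqxx expr2.
  rewrite leq_eqVlt ltnS => /orP[/eqP ->|kn].
    by rewrite Cn1 Dn1 add0r /q eqxx orbT expr2.
  by rewrite /C /D /q !along1 // !eqSS (ltn_eqF kn) /= !mulr0 !addr0 Wcd.
have q1n : q 1%N + q n = p.
  rewrite /q !eqSS (ltn_eqF n0) (gtn_eqF n0) (ltn_eqF (ltnSn n)) /= /nd s0 sn.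
  by rewrite -opprD Bcd eqxx mulr1 opprK.
have ts := chain_order_mem t chain.
have its : (index t s < n)%N by rewrite -index_mem sz in ts.
(* The value 1 of [q] occurs at the position of [t], where [B t t = -1]. *)
have [|//|q01 cop C1 Cpos] := chain_rec_fraction (k0 := (index t s).+1) a2 p0 recC recD
  C0 Cn1 D0 Dn1 Cn D1 qE q1n.
- by rewrite ltnS ltnW.
- by rewrite /q !eqSS (ltn_eqF its) /= /nd nth_index // Btt opprK.
have /andP[q0 qp] := q01.
have [pE q1E] : p = `|p|%N%:Z /\ q 1%N = `|q 1%N|%N%:Z by split; lia.
exists `|p|%N, `|q 1%N|%N, s; split=> //; first by split=> //; lia.
have -> : [seq weight v | v <- s] = [seq a k | k <- iota 1 n.-1.+1].
  apply: (@eq_from_nth _ 0) => [|i]; first by rewrite !size_map size_iota sz prednK.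
  rewrite size_map sz => ni; rewrite (nth_map c) ?sz // (nth_map 0%N) ?size_iota ?prednK //.
  by rewrite nth_iota ?prednK.
rewrite (@hj_value_chain_rec a C).
- have -> : C 0%N = (`|p| ^ 2)%N%:Z by rewrite C0; nia.
  have -> : C 1%N = (`|p| * `|q 1%N| - 1)%N%:Z by rewrite C1; nia.
  by rewrite !pmulrn.
- by move=> k kn; apply: recC; lia.
- by move=> k kn; apply: lt0r_neq0; apply: Cpos; lia.
- by rewrite add0n prednK.
Qed.

End NormalForms.

(** * From embeddings to normal forms, and conclusion *)

(** Describing the ends by their degree makes the final claim independent of the chosen order of the
    chain. *)
Lemma chain_order_end n (e : rel 'I_n) (s : seq 'I_n) v : (1 < n)%N -> chain_order e s ->
  (#|[set u | e v u]| <= 1)%N = (index v s == 0)%N || (index v s == n.-1)%N.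
Proof.
move=> n1 chain; have [us sz adj] := chain.
have idx u : (index u s < n)%N by rewrite -[X in (_ < X)%N]sz index_mem (chain_order_mem _ chain).
have idxI u w : index u s = index w s -> u = w.
  by move=> E; rewrite -(nth_index v (chain_order_mem u chain)) E nth_index // (chain_order_mem _ chain).
have idxn k : (k < n)%N -> index (nth v s k) s = k by move=> kn; rewrite index_uniq ?sz.
apply/idP/idP => [|vend].
  apply: contraTT; rewrite negb_or => /andP[i0 in1]; rewrite -ltnNge.
  have iv := idx v.
  apply/card_gt1P; exists (nth v s (index v s).-1), (nth v s (index v s).+1).
  rewrite !inE !adj !idxn; try lia.
  split; [by apply/orP; right; lia | by rewrite eqxx |].
  by apply/eqP => /(congr1 (index^~ s)); rewrite !idxn; lia.
apply/card_le1_eqP => u w; rewrite !inE !adj => hu hw.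
by apply: idxI; have := idx v; have := idx u; have := idx w; lia.
Qed.

Lemma card_index_type n (phi : 'I_n -> 'I_n -> int) i m x :
  index_type phi i m -> x != 0 -> #|[set v | phi v i == x]| = count_mem x m.
Proof.
move=> /permP/(_ (pred1 x)) <- x0; rewrite /nz_coeffs count_map count_filter.
rewrite cardE -size_filter; congr (size _); rewrite /enum_mem -filter_predI.
apply: eq_filter => v; rewrite /= !inE /=.
by case: (eqVneq (phi v i) x) => [->|]; rewrite ?x0.
Qed.

Lemma index_type_mem n (phi : 'I_n -> 'I_n -> int) i m v :
  index_type phi i m -> phi v i != 0 -> phi v i \in m.
Proof.
move=> /perm_mem <- nz; apply/mapP; exists v => //.
by rewrite mem_filter nz mem_enum.
Qed.

Lemma is_tree_relabel n (e : rel 'I_n) (f : 'I_n -> 'I_n) :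
  injective f -> is_tree e -> is_tree (fun u v => e (f u) (f v)).
Proof.
move=> fI [n0 sym irr conn acyc]; split=> //.
- have [g gK fK] := injF_bij fI.
  move=> u v; have /connectP[p pp lp] := conn (f u) (f v).
  apply/connectP; exists (map g p).
    rewrite -[u]gK path_map; apply: sub_path pp => x y /=.
    by rewrite !fK.
  by rewrite -[u in RHS]gK last_map -lp gK.
move=> c uc sc; have := acyc (map f c).
rewrite map_inj_uniq // size_map => /(_ uc sc); apply: contra.
by case: c {uc sc} => //= x p; rewrite -map_rcons path_map.
Qed.

(** All coefficients lie in 0, 1, -1, -2, and adjunction allows at most one 1 or -2 per vertex.
    Sending an index to the vertex with its head there is thus injective, hence a relabelling. *)
Lemma symplectic_normal_form n (e : rel 'I_n) d phi (t t5 : 'I_n) :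
  in_S_via e d phi -> type6 phi t -> type5 phi t5 ->
  (forall i, i != t -> i != t5 -> type4 phi i || type7 phi i) ->
  exists2 f : 'I_n -> 'I_n, injective f &
    let r u i := phi (f u) i == -1 in
    normal_form t t5 (fun u v => e (f u) (f v)) r /\
    forall u i, phi (f u) i = coef t t5 r u i.
Proof.
move=> [tree mini [gram dec adj]] T6 T5 T47.
have t5t : t5 != t.
  apply/eqP => E; have := card_index_type (x := 1) T6 isT.
  by rewrite -E (card_index_type T5).
have c5 x : x != 0 -> #|[set v | phi v t5 == x]| = count_mem x [:: 1; -2].
  exact: card_index_type.
have entry v i : phi v i \in [:: 0; 1; -1; -2].
  case: (eqVneq (phi v i) 0) => [->//|nz].
  have sub m : index_type phi i m -> all (mem [:: 1; -1; -2]) m -> phi v i \in [:: 0; 1; -1; -2].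
    by move=> T /allP/(_ _ (index_type_mem T nz)) /= h; rewrite inE h orbT.
  case: (eqVneq i t) => [it|it]; first by apply: sub (_ : index_type _ _ [:: -1; -1]) _; rewrite ?it.
  case: (eqVneq i t5) => [i5|i5]; first by apply: sub (_ : index_type _ _ [:: 1; -2]) _; rewrite ?i5.
  by case/orP: (T47 i it i5) => /sub; apply.
have adj2 v : \sum_i (phi v i ^+ 2 + phi v i) = 2.
  apply/eqP; rewrite -eqr_opp -(adj v) /Qn /Kvec -opprD -big_split /=.
  by apply/eqP; congr (- _); apply: eq_bigr => i _; rewrite mulr1 addrC expr2.
have heads v i j : phi v i \in [:: 1; -2] -> phi v j \in [:: 1; -2] -> i = j.
  move=> hi hj; apply/eqP; apply: contraT => ij.
  have two k : phi v k \in [:: 1; -2] -> phi v k ^+ 2 + phi v k = 2.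
    by rewrite !inE => /orP[]/eqP ->.
  have := adj2 v; rewrite (bigD1 i) //= (bigD1 j) 1?eq_sym //= !two //.
  have : 0 <= \sum_(k < n | (k != i) && (k != j)) (phi v k ^+ 2 + phi v k).
    by apply: sumr_ge0 => k _; have := entry v k; rewrite !inE => /or4P[]/eqP ->.
  by move: (\sum_(k < n | _) _) => x; lia.
have col1 i : i != t -> #|[set v | (phi v i == 1)%R]| = 1%N.
  move=> it; case: (eqVneq i t5) => [->|i5]; first by rewrite c5.
  by have /orP[T|T] := T47 i it i5; rewrite (card_index_type T).
(* Column [t] has no head, so the label [t] goes to the vertex with the coefficient -2. *)
have ex i : exists v, phi v (if i == t then t5 else i) == (if i == t then -2 else 1).
  case: (eqVneq i t) => [_|it].
    have : (0 < #|[set v | (phi v t5 == -2)%R]|)%N by rewrite c5.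
    by move=> /card_gt0P[v]; rewrite inE; exists v.
  have : (0 < #|[set v | (phi v i == 1)%R]|)%N by rewrite col1.
  by move=> /card_gt0P[v]; rewrite inE; exists v.
have [f Hf] := fin_all_exists ex.
have fI : injective f.
  move=> i j E; have := Hf i; have := Hf j; rewrite E.
  have := heads (f j) (if i == t then t5 else i) (if j == t then t5 else j).
  case: (eqVneq i t) => [->|it]; case: (eqVneq j t) => [-> //|jt] H /eqP Hj /eqP Hi.
  - by move: H; rewrite Hi Hj => /(_ isT isT) E5; move: Hi; rewrite E5 Hj.
  - by move: H; rewrite Hi Hj => /(_ isT isT) E5; move: Hj; rewrite -E5 Hi.
  - by apply: H; rewrite ?Hi ?Hj.
have [g gK fK] := injF_bij fI.
exists f => // r.
have hd u i : i != (if u == t then t5 else u) -> phi (f u) i = - (r u i)%:R.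
  move=> iu; rewrite /r; have := entry (f u) i; have := heads (f u) i (if u == t then t5 else u).
  rewrite (eqP (Hf u)) !inE => H /or4P[]/eqP E; rewrite E //.
    by case/eqP: iu; apply: H; rewrite ?E //; case: ifP.
  by case/eqP: iu; apply: H; rewrite ?E //; case: ifP.
have cE u i : phi (f u) i = coef t t5 r u i.
  have := Hf u; have := hd u i; rewrite /coef /head_coef /r.
  case: (eqVneq u t) => ut.
    case: (eqVneq i t5) => [-> _ /eqP -> //|i5 h _].
    by rewrite sub0r; apply: h.
  case: (eqVneq u i) => [<- _ /eqP -> //|ui h _].
  by rewrite sub0r; apply: h.
have tE i m : index_type phi i m -> tails r setT i = count_mem (-1 : int) m.
  move=> T; rewrite -(card_index_type T) // /tails -[LHS](card_imset _ fI).
  apply: eq_card => v; rewrite [RHS]inE; apply/imsetP/idP => [[u]|pv].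
    by rewrite !inE /= => ru ->.
  by exists (g v); rewrite ?fK // !inE /r fK.
split=> //; split=> //.
- exact: is_tree_relabel.
- move=> u v uv; have := gram (f u) (f v); rewrite (inj_eq fI) uv /Qn => /(_ isT).
  under eq_bigr => i _ do rewrite !cE.
  by move=> H; rewrite -[LHS]opprK H; case: (e _ _).
- move=> u; apply/negP => ru; have := tE _ _ T5; rewrite /= => /eqP.
  by rewrite cards_eq0 => /eqP/setP/(_ u); rewrite !inE ru.
- by move=> u /negPf ut; have := Hf u; rewrite ut /r => /eqP ->.
- by rewrite (tE _ _ T6).
- by move=> i it i5; case/orP: (T47 i it i5) => T; rewrite (tE _ _ T).
(* A row consisting of a single 1 would have decoration -1, against minimality. *)
- move=> u ut; apply/existsP; apply: contraT; rewrite negb_exists => /forallP nr.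
  have := mini (f u); rewrite -dec /Qn (bigD1 u) //= big1 => [|i iu].
    by have := Hf u; rewrite (negPf ut) => /eqP ->.
  by rewrite hd ?(negPf ut) // (negPf (nr i)) mulr0.
Qed.

Theorem theorem3p12 (n : nat) (e : rel 'I_n) (d : 'I_n -> int)
    (phi : 'I_n -> 'I_n -> int) (t t5 : 'I_n) :
  in_S_via e d phi ->
  type6 phi t -> (forall i, type6 phi i -> i = t) ->
  type5 phi t5 -> (forall i, type5 phi i -> i = t5) ->
  (forall i, i != t -> i != t5 -> type4 phi i || type7 phi i) ->
  in_G e d /\
  (forall s : seq 'I_n, chain_order e s ->
     [set v | phi v t != 0] = [set v | (index v s == 0)%N || (index v s == n.-1)%N]).
Proof.
move=> S T6 _ T5 _ T47.
have [f fI [nf phiE]] := symplectic_normal_form S T6 T5 T47.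
have [tree _ [_ dec _]] := S.
set e' := (fun u v => e (f u) (f v)) in nf.
set r := (fun u i => phi (f u) i == -1) in nf phiE.
have [g gK fK] := injF_bij fI.
have dE u : d (f u) = - weight t t5 r u.
  rewrite -dec /Qn; congr (- _); apply: eq_bigr => i _.
  by rewrite -expr2 phiE.
split.
  have [p [q [s [pq [us sz adj] hj]]]] := normal_form_chain nf.
  exists p, q, [seq weight t t5 r v | v <- s], (map f s); split=> //.
  - split=> //; first by case: (s) sz => // sz; have := ltn_ord t; rewrite -[X in (_ < X)%N]sz.
    by apply/allP => _ /mapP[v _ ->]; apply: (weight_ge2 nf).
  - split; rewrite ?map_inj_uniq ?size_map // => u v.
    by rewrite -[u]fK -[v]fK !index_map // -adj.
  - by rewrite -!map_comp; apply: eq_map => v /=.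
move=> s chain.
have n1 : (1 < n)%N.
  have : (t5 : nat) != t := nf_neq nf.
  have := ltn_ord t; have := ltn_ord t5; lia.
(* Ends have degree at most one, and the degree drops from 2 to 1 exactly at the vertices meeting
   [E_t]. *)
apply/setP => v; rewrite !inE -(chain_order_end v n1 chain) -[v]fK.
have -> : (phi (f (g v)) t != 0) = r (g v) t.
  rewrite phiE (coef_t nf); by case: (r _ _).
have := degree nf (g v).
have -> : (\sum_u e' (g v) u)%N = #|[set u | e (f (g v)) u]|.
  rewrite -sum1_card [RHS]big_mkcond [RHS](reindex f) /=; last by exists g => x _.
  by apply: eq_bigr => u _; rewrite inE /e'; case: (e _ _).
by case: (r _ _); lia.
Qed.
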